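(* Let $M$ be a hosohedral-type monoid. If $\alpha,\beta\in G(M)$ are such that $\alpha^n=\beta^n$ for some nonzero integer $n$, then either $\alpha$ and $\beta$ are conjugate in $G(M)$, or $\alpha$ and $\beta$ are nonconjugate periodic elements of $G(M)$.
   Context: For positive integers $m,\ell$, consider letters $a_0,\ldots,a_{m-1}$ with indices read modulo $m$, and for $i\in\mathbb{Z}$, $p\geq 1$ let $s(i,p)=a_ia_{i+1}\cdots a_{i+p-1}$ (a product of $p$ consecutive letters). The circular monoid $M(m,\ell)$ is the monoid with generators $a_0,\ldots,a_{m-1}$ and relations $s(i,\ell)=s(i+1,\ell)$ for all $i\in\{0,\ldots,m-1\}$. Its Garside element is $s(0,\ell)$. A hosohedral-type monoid is a $\Delta$-product $M=M(m_1,\ell_1)*_\Delta\cdots*_\Delta M(m_h,\ell_h)$ ($h\geq 1$) of circular monoids, i.e. the quotient of the free product of the monoids $M(m_j,\ell_j)$ by the relations identifying the Garside elements $\Delta_1,\ldots,\Delta_h$ of all the factors with each other. Let $\Delta\in M$ be their common image, and $G(M)$ the enveloping group of $M$ (the group with the same presentation). An element $\rho\in G(M)$ is periodic if $\rho^p=\Delta^q$ for some integers $p,q$ with $p\neq 0$. *)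

(* Defs.v *)
From HB Require Import structures.
From mathcomp Require Import all_boot ssrint.
From mathcomp Require Import boolp.

Set Implicit Arguments.
Unset Strict Implicit.
Unset Printing Implicit Defensive.

Import Algebra.

Local Open Scope group_scope.
Local Open Scope quotient_scope.

(* A monoid presentation by generators and positive relations, together with
   a word representing the Garside element. *)
Record presentation := Presentation {
  gens : choiceType;
  rels : seq gens -> seq gens -> Prop;
  garside : seq gens
}.

(* [factor_word i p] is s(i, p) = a_i a_{i+1} ... a_{i+p-1}: [ordS] is the
   cyclic successor of 'I_m. *)
Definition factor_word (m : nat) (i : 'I_m) (p : nat) : seq 'I_m :=
  traject (@ordS m) i p.

Variant circular_rel (m l : nat) : seq 'I_m -> seq 'I_m -> Prop :=
  CircularRel (i : 'I_m) :
    circular_rel l (factor_word i l) (factor_word (ordS i) l).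

Definition circular (m l : nat) (m_gt0 : 0 < m) : presentation :=
  {| gens := 'I_m;
     rels := @circular_rel m l;
     garside := factor_word (Ordinal m_gt0) l |}.

Section DeltaProduct.
Variables (h : nat) (P : 'I_h -> presentation).

Definition dprod_gens : choiceType := {j : 'I_h & gens (P j)}.

Definition dprod_in (j : 'I_h) (w : seq (gens (P j))) : seq dprod_gens :=
  [seq Tagged (fun k => gens (P k)) x | x <- w].

Variant dprod_rel : seq dprod_gens -> seq dprod_gens -> Prop :=
| DprodFactor j u v of rels u v : dprod_rel (@dprod_in j u) (dprod_in v)
| DprodGarside j k :
    dprod_rel (dprod_in (garside (P j))) (dprod_in (garside (P k))).

(* The Garside words of all factors are identified, so the choice of the factor
   of index 0 is immaterial. *)
Definition delta_product (h_gt0 : 0 < h) : presentation :=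
  {| gens := dprod_gens;
     rels := dprod_rel;
     garside := dprod_in (garside (P (Ordinal h_gt0))) |}.

End DeltaProduct.

Definition hosohedral (h : nat) (h_gt0 : 0 < h) (m l : 'I_h -> nat)
    (m_gt0 : forall j, 0 < m j) : presentation :=
  delta_product (fun j => circular (l j) (m_gt0 j)) h_gt0.

Section EnvelopingGroup.
Variable P : presentation.

(* The letter (x, true) stands for x and (x, false) for its inverse. *)
Definition positive_word (w : seq (gens P)) : seq (gens P * bool) :=
  [seq (x, true) | x <- w].

Inductive word_eq : seq (gens P * bool) -> seq (gens P * bool) -> Prop :=
| WordRefl w : word_eq w w
| WordSym u v : word_eq u v -> word_eq v u
| WordTrans u v w : word_eq u v -> word_eq v w -> word_eq u w
| WordCat u u' v v' :
    word_eq u u' -> word_eq v v' -> word_eq (u ++ v) (u' ++ v')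
| WordCancel x b : word_eq [:: (x, b); (x, ~~ b)] [::]
| WordRel u v of rels u v : word_eq (positive_word u) (positive_word v).

Definition word_eqb (u v : seq (gens P * bool)) : bool := `[< word_eq u v >].

Lemma word_eqb_refl : reflexive word_eqb.
Proof. by move=> u; apply/asboolP/WordRefl. Qed.

Lemma word_eqb_sym : symmetric word_eqb.
Proof. by move=> u v; apply/asboolP/asboolP; apply: WordSym. Qed.

Lemma word_eqb_trans : transitive word_eqb.
Proof.
by move=> v u w /asboolP uv /asboolP vw; apply/asboolP/(WordTrans uv vw).
Qed.

Canonical word_equiv :=
  EquivRel word_eqb word_eqb_refl word_eqb_sym word_eqb_trans.

Definition envgroup := {eq_quot word_equiv}.

HB.instance Definition _ := EqQuotient.on envgroup.
HB.instance Definition _ := Choice.on envgroup.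

Definition env_class (w : seq (gens P * bool)) : envgroup := \pi_envgroup w.

Definition inv_word (w : seq (gens P * bool)) : seq (gens P * bool) :=
  rev [seq (x.1, ~~ x.2) | x <- w].

Definition env_one : envgroup := env_class [::].
Definition env_mul (a b : envgroup) : envgroup := env_class (repr a ++ repr b).
Definition env_inv (a : envgroup) : envgroup := env_class (inv_word (repr a)).

Lemma env_classP u v : env_class u = env_class v <-> word_eq u v.
Proof.
split=> [/eqmodP/asboolP // | uv]; by apply/eqmodP/asboolP.
Qed.

Lemma repr_class w : word_eq (repr (env_class w)) w.
Proof. by apply/env_classP; rewrite /env_class reprK. Qed.

Lemma env_reprK (a : envgroup) : env_class (repr a) = a.
Proof. by rewrite /env_class reprK. Qed.

Lemma inv_word_cat u v : inv_word (u ++ v) = inv_word v ++ inv_word u.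
Proof. by rewrite /inv_word map_cat rev_cat. Qed.

Lemma inv_wordK : involutive inv_word.
Proof.
move=> w; rewrite /inv_word map_rev revK -map_comp map_id_in // => -[x b] _ /=.
by rewrite negbK.
Qed.

Lemma word_mulV w : word_eq (w ++ inv_word w) [::].
Proof.
elim: w => [|[x b] w IHw]; first exact: WordRefl.
have -> : ((x, b) :: w) ++ inv_word ((x, b) :: w)
    = [:: (x, b)] ++ (w ++ inv_word w) ++ [:: (x, ~~ b)].
  by rewrite -cat1s inv_word_cat /= !catA.
apply: (WordTrans _ (WordCancel x b)).
apply: (@WordCat [:: _] [:: _] _ [:: _] (WordRefl _)).
exact: (@WordCat _ [::] _ _ IHw (WordRefl _)).
Qed.

Lemma word_mulVl w : word_eq (inv_word w ++ w) [::].
Proof. by rewrite -{2}(inv_wordK w); apply: word_mulV. Qed.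

Lemma env_mulE u v : env_mul (env_class u) (env_class v) = env_class (u ++ v).
Proof. by apply/env_classP/WordCat; apply: repr_class. Qed.

Lemma env_mulA : associative env_mul.
Proof.
move=> a b c; rewrite -(env_reprK a) -(env_reprK b) -(env_reprK c).
by rewrite !env_mulE catA.
Qed.

Lemma env_mul1 : left_id env_one env_mul.
Proof. by move=> a; rewrite -(env_reprK a) env_mulE. Qed.

Lemma env_mulg1 : right_id env_one env_mul.
Proof. by move=> a; rewrite -(env_reprK a) env_mulE cats0. Qed.

Lemma env_mulV : left_inverse env_one env_inv env_mul.
Proof.
move=> a; rewrite -{2}(env_reprK a) /env_inv env_mulE.
exact/env_classP/word_mulVl.
Qed.

Lemma env_mulgV : right_inverse env_one env_inv env_mul.
Proof.
move=> a; rewrite -{1}(env_reprK a) /env_inv env_mulE.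
exact/env_classP/word_mulV.
Qed.

HB.instance Definition _ :=
  isGroup.Build envgroup env_mulA env_mul1 env_mulg1 env_mulV env_mulgV.

Definition env_garside : envgroup := env_class (positive_word (garside P)).

End EnvelopingGroup.

Definition expgz (G : groupType) (x : G) (n : int) : G :=
  match n with
  | Posz k => x ^+ k
  | Negz k => x ^- k.+1
  end.

Definition conjugate (G : groupType) (x y : G) : Prop := exists g : G, y = x ^ g.

Definition periodic (P : presentation) (r : envgroup P) : Prop :=
  exists p q : int, p <> 0%Z /\ expgz r p = expgz (env_garside P) q.

(* Main.v *)
Require Import Defs.
From mathcomp Require Import all_boot ssralg ssrint intdiv.
From mathcomp Require Import boolp.
From mathcomp Require Import zify.

(** The group [G] is, up to finite index, central-by-free, and this forces
    roots to be unique outside the periodic elements: if [alpha ^+ n] and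
    [beta ^+ n] agree, then [alpha = beta] or both are periodic.

    Let [L] be the product of the [l j]. Giving each letter of the factor [j]
    the weight [L / l j] makes every relation homogeneous, so the weight is a
    homomorphism from [G] to the integers, and the Garside element [Delta] has
    weight [L]. Conjugation by [Delta] shifts the indices of the factor [j] by
    [l j], hence the power [z] of [Delta] whose exponent is the product of the
    [m j] is central; its weight [kappa] is positive. Suppose that the kernel
    [K] of the weight embeds in a free group. Two elements [alpha] and [beta]
    with a common [n]-th power have the same weight [w], so dividing
    [alpha ^+ kappa] and [beta ^+ kappa] by the power of [z] of exponent [w]
    gives two elements of [K] with a common [n]-th power; by uniqueness of roots
    in [K] ([free_group_root_unique]) they are a single element [f]. If [f = 1],
    both [alpha] and [beta] are periodic. Otherwise [g = beta / alpha] is in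
    [K] and commutes with [f], so some positive power of [g] is a power of [f]
    ([free_group_commute]). That power commutes with [alpha], hence so does
    [g], by uniqueness of roots again; comparing [n]-th powers gives
    [g ^+ n = 1], and [g = 1]. This is [roots_equal_or_central].

    The embedding of [K] comes from reading a word while recording the weight
    of the prefix already read, its level. Attach to each letter [x] and each
    level [k] an element [potential x k] of [G], in such a way that going from
    [(x, k)] to the next letter of the circle, at the level [k] plus the weight
    of [x], multiplies the potential by [x], up to correction by powers of
    [Delta] which depend on the levels only. A product of [l j] consecutive
    letters is [Delta] and raises the level by [L], and the correction is
    chosen so that the potential is back to its initial value
    ([potential_period]). Now replace [x], read at level [k], by the quotient
    of the two potentials, taken not in [G] but in the free group on the
    underlying set of [G]: along each side of a relation the product
    telescopes to [1], so the substitution is well defined on [G], and it is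
    multiplicative on [K]. Evaluating the free group back in [G] recovers the
    element ([free_eval_to_free]), whence injectivity on [K]. *)

Set Implicit Arguments.
Unset Strict Implicit.
Unset Printing Implicit Defensive.

Import Algebra GRing.Theory.

Local Open Scope group_scope.

(** * Words and their classes *)

Section EnvelopingClasses.
Variable P : presentation.

Lemma env_class_cat (u v : seq (gens P * bool)) :
  env_class (u ++ v) = env_class u * env_class v.
Proof. by rewrite -env_mulE. Qed.

Lemma env_class_inv (w : seq (gens P * bool)) :
  env_class (inv_word w) = (env_class w)^-1.
Proof.
apply: (mulgI (env_class w)); rewrite mulgV -env_class_cat.
exact/env_classP/word_mulV.
Qed.

Lemma env_class_flatten_nseq (w : seq (gens P * bool)) n :
  env_class (flatten (nseq n w)) = env_class w ^+ n.
Proof. by elim: n => [//|n IHn] /=; rewrite env_class_cat IHn expgS. Qed.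

Lemma size_inv_word (w : seq (gens P * bool)) : size (inv_word w) = size w.
Proof. by rewrite size_rev size_map. Qed.

End EnvelopingClasses.

(** * Free groups: unique roots and commuting elements *)

Section FreeGroup.
Variable X : choiceType.

Definition free_pres : presentation := @Presentation X (fun _ _ => False) [::].

Notation letter := (gens free_pres * bool)%type.
Notation word := (seq letter).

Definition inv_letter (x : letter) : letter := (x.1, ~~ x.2).

Lemma inv_letterK : involutive inv_letter.
Proof. by case=> x b; rewrite /inv_letter /= negbK. Qed.

Lemma inv_letter_neq x : inv_letter x != x.
Proof. by case: x => x b; rewrite xpair_eqE eqxx /=; case: b. Qed.

Definition reduced : pred word := sorted (fun x y => y != inv_letter x).

Definition cons_reduce (x : letter) (w : word) : word :=
  if w is y :: w' then if y == inv_letter x then w' else x :: w else [:: x].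

Definition reduce (w : word) : word := foldr cons_reduce [::] w.

Lemma cons_reduce_reduced x w : reduced w -> reduced (cons_reduce x w).
Proof.
case: w => [//|y w] /= red_w; case: ifP => [_|neq].
  exact: path_sorted red_w.
by rewrite /reduced /= neq.
Qed.

Lemma cons_reduceK x w :
  reduced w -> cons_reduce x (cons_reduce (inv_letter x) w) = w.
Proof.
case: w => [|y w] /=; first by rewrite eqxx.
rewrite inv_letterK; case: eqP => [->|_] /=; last by rewrite eqxx.
by case: w => [//|z w] /= /andP[/negPf -> _].
Qed.

Lemma foldr_reduce_reduced u w : reduced w -> reduced (foldr cons_reduce w u).
Proof.
by move=> red_w; elim: u => [//|x u IHu]; apply: cons_reduce_reduced.
Qed.

Lemma reduce_reduced w : reduced (reduce w).
Proof. exact: foldr_reduce_reduced. Qed.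

(** Letters act on reduced words through [cons_reduce], and by
    [cons_reduceK] the actions of a letter and of its inverse cancel; so this
    action factors through the free group, which makes reduced words normal
    forms. *)
Lemma word_eq_foldr (u v : word) :
  word_eq u v ->
  forall w, reduced w -> foldr cons_reduce w u = foldr cons_reduce w v.
Proof.
elim=> {u v} [//|u v _ IH w ?|u v t _ IH1 _ IH2 w ?|u u' v v' _ IH1 _ IH2 w ?
  |x b w ?|u v []].
- by rewrite IH.
- by rewrite IH1 ?IH2.
- by rewrite !foldr_cat IH2 // IH1 //; apply: foldr_reduce_reduced.
- exact: (@cons_reduceK (x, b)).
Qed.

Lemma reduce_env_class (u v : word) :
  @env_class free_pres u = env_class v -> reduce u = reduce v.
Proof. by move/env_classP/word_eq_foldr; apply. Qed.

Lemma env_class_cons_reduce x w :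
  @env_class free_pres (cons_reduce x w) = env_class (x :: w).
Proof.
case: w => [//|y w] /=; case: eqP => // ->.
rewrite -[w in LHS]cat0s -[_ :: _ :: _ in RHS](cat_cons _ [:: _]).
rewrite !env_class_cat.
by congr (_ * _); apply/env_classP/WordSym; case: x => x b; apply: WordCancel.
Qed.

Lemma env_class_reduce w : @env_class free_pres (reduce w) = env_class w.
Proof.
elim: w => [//|x w IHw]; rewrite env_class_cons_reduce.
by rewrite -cat1s env_class_cat IHw -env_class_cat.
Qed.

Lemma reduced_env_class (x : envgroup free_pres) :
  exists2 w, reduced w & x = env_class w.
Proof.
exists (reduce (repr x)); first exact: reduce_reduced.
by rewrite env_class_reduce env_reprK.
Qed.

Lemma size_cons_reduce x w : size (cons_reduce x w) <= (size w).+1.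
Proof. by case: w => [|y w] //=; case: ifP => _ //=; lia. Qed.

Lemma reduce_id w : reduced w -> reduce w = w.
Proof.
elim: w => [//|x w IHw] red_w; rewrite /= IHw; last exact: path_sorted red_w.
by case: w red_w {IHw} => [//|y w] /= /andP[/negPf -> _].
Qed.

Lemma reduced_class_inj u v : reduced u -> reduced v ->
  @env_class free_pres u = env_class v -> u = v.
Proof. by move=> red_u red_v /reduce_env_class; rewrite !reduce_id. Qed.

(** Each cancellation strictly shortens a word. This recognizes reduced words
    by their length alone, as needed for a product written in two ways. *)
Lemma reduced_size_reduce w : size w <= size (reduce w) -> reduced w.
Proof.
elim: w => [//|x w IHw].
rewrite -[reduce _]/(cons_reduce x (reduce w)) [size (_ :: _)]/=.
have le_xw := size_cons_reduce x (reduce w) => le_rw.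
have red_w : reduced w by apply: IHw; rewrite -ltnS; apply: leq_trans le_xw.
move: le_rw; rewrite (reduce_id red_w); case: w red_w {IHw le_xw} => //.
move=> y w red_w /=; case: eqP => /= [_|/eqP neq _].
  by rewrite ltnNge leqnSn.
exact: red_w.
Qed.

Lemma reduced_catM u v w : v != [::] ->
  reduced (u ++ v) -> reduced (v ++ w) -> reduced (u ++ v ++ w).
Proof.
case: v => [//|x v] _; rewrite /reduced cat_cons !sorted_cat_cons.
by move=> /andP[-> _].
Qed.

Lemma reduced_inv_word w : reduced (inv_word w) = reduced w.
Proof.
rewrite /reduced /inv_word rev_sorted sorted_map; case: w => //= x w.
apply: (eq_path _ x w) => {w}x y /=.
by rewrite /inv_letter negbK eq_sym; case: y.
Qed.

(** Strip the end letters as long as they are inverse to each other; what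
    remains is cyclically reduced, and not empty because a reduced word never
    has the form [u ++ inv_word u] with [u] nonempty. *)
Lemma cyclic_reduction w : reduced w -> w != [::] ->
  exists u c : word,
    [/\ w = u ++ c ++ inv_word u, c != [::] & reduced (c ++ c)].
Proof.
have [n] := ubnP (size w); elim: n w => // n IHn [//|x w] /ltnSE le_n red_w _.
elim/last_ind: w le_n red_w => [|w y _] le_n red_w.
  by exists [::], [:: x]; rewrite /reduced /= eq_sym inv_letter_neq.
case: (eqVneq y (inv_letter x)) => [def_y|neq_y]; last first.
  exists [::], (x :: rcons w y); rewrite cats0; split=> //.
  rewrite {1}/reduced sorted_cat_cons -/(reduced _) [path _ _ _]red_w andbT.
  rewrite -rcons_cons /= rcons_path [path _ _ _]red_w last_rcons /=.
  by rewrite -(can_eq inv_letterK) inv_letterK eq_sym.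
rewrite {y}def_y in le_n red_w *.
have red_w' : reduced w.
  by move: red_w; rewrite /reduced /= rcons_path => /andP[/path_sorted].
have w_neq0 : w != [::].
  by case: w red_w {le_n red_w'} => //=; rewrite /reduced /= eqxx.
have [|u [c [def_w c_neq0 red_cc]]] := IHn w _ red_w' w_neq0.
  by move: le_n; rewrite /= size_rcons; apply: leq_trans.
exists (x :: u), c; split=> //.
rewrite -[x :: u]cat1s inv_word_cat def_w -cats1 -!catA.
by case: (x).
Qed.

Lemma size_flatten_nseq (T : Type) n (c : seq T) :
  size (flatten (nseq n c)) = (n * size c)%N.
Proof. by elim: n => [//|n IHn] /=; rewrite size_cat IHn mulSn. Qed.

Lemma reduced_conj_power u c n :
  c != [::] -> reduced (c ++ c) -> reduced (u ++ c ++ inv_word u) -> 0 < n ->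
  reduced (u ++ flatten (nseq n c) ++ inv_word u).
Proof.
move=> c_neq0 red_cc red_ucu; case: n => // n _.
elim: n => [|n IHn]; first by rewrite /= cats0.
rewrite -[flatten _]/(c ++ c ++ flatten (nseq n c)) -!catA.
apply: reduced_catM => //.
  by move: red_ucu; rewrite catA => /cat_sorted2[].
apply: reduced_catM => //.
move: IHn; rewrite -[flatten _]/(c ++ flatten (nseq n c)) -!catA.
by case/cat_sorted2.
Qed.

(** Writing [x] as a conjugate of a cyclically reduced element makes the
    normal forms of all its powers explicit, with a length affine in the
    exponent. *)
Lemma free_group_power_word (x : envgroup free_pres) : x <> 1 ->
  exists u c : word, [/\ c != [::],
    x = env_class u * env_class c * (env_class u)^-1, reduced (c ++ c)
    & forall n, 0 < n ->
      let w := u ++ flatten (nseq n c) ++ inv_word u in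
      reduced w /\ x ^+ n = env_class w].
Proof.
have [w red_w ->] := reduced_env_class x => w_neq1.
have w_neq0 : w != [::] by apply/eqP => w0; apply: w_neq1; rewrite w0.
have [u [c [def_w c_neq0 red_cc]]] := cyclic_reduction red_w w_neq0.
have def_cw : @env_class free_pres w
    = env_class u * env_class c * (env_class u)^-1.
  by rewrite def_w !env_class_cat env_class_inv mulgA.
exists u, c; split=> // n n_gt0 w'; split.
  by apply: reduced_conj_power => //; rewrite -def_w.
rewrite def_cw !env_class_cat env_class_inv env_class_flatten_nseq.
by rewrite -{1}[env_class u]invgK -mulgA -conjgE -conjXg conjgE invgK mulgA.
Qed.

Lemma free_group_torsion_free (x : envgroup free_pres) n :
  0 < n -> x ^+ n = 1 -> x = 1.
Proof.
move=> n_gt0 xn1; have [//|/eqP] := eqVneq x 1.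
case/free_group_power_word=> u [c [c_neq0 _ _]].
case/(_ n n_gt0) => red_w; rewrite xn1.
move=> /(@reduced_class_inj [::] _ isT red_w).
move/(congr1 size); rewrite !size_cat size_flatten_nseq /=.
have : 0 < size c by case: (c) c_neq0.
by move: (size u) (size c) (size (inv_word u)) n_gt0 => *; nia.
Qed.

Lemma flatten_nseq_inj (T : eqType) n (c d : seq T) : 0 < n ->
  size c = size d -> flatten (nseq n c) = flatten (nseq n d) -> c = d.
Proof.
by case: n => //= n _ eq_size /eqP; rewrite eqseq_cat // => /andP[/eqP].
Qed.

(** The lengths of the normal forms of the powers of exponents [n] and [2 * n]
    determine the lengths of the conjugating part and of the cyclically reduced
    part; normal forms then agree block by block. *)
Lemma free_group_root_unique (x y : envgroup free_pres) n :
  0 < n -> x ^+ n = y ^+ n -> x = y.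
Proof.
move=> n_gt0 eq_xy.
have [x1|/eqP x_neq1] := eqVneq x 1.
  rewrite x1 expg1n in eq_xy.
  by rewrite x1 (free_group_torsion_free n_gt0 (esym eq_xy)).
have [y1|/eqP y_neq1] := eqVneq y 1.
  rewrite y1 expg1n in eq_xy.
  by rewrite y1 (free_group_torsion_free n_gt0 eq_xy).
have [u [c [_ def_x _ powx]]] := free_group_power_word x_neq1.
have [v [d [_ def_y _ powy]]] := free_group_power_word y_neq1.
have eq_word k : 0 < k -> u ++ flatten (nseq (n * k)%N c) ++ inv_word u
    = v ++ flatten (nseq (n * k)%N d) ++ inv_word v.
  move=> k_gt0; have nk_gt0 : 0 < (n * k)%N by rewrite muln_gt0 n_gt0.
  have [red_x eq_x] := powx _ nk_gt0; have [red_y eq_y] := powy _ nk_gt0.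
  by apply: reduced_class_inj => //; rewrite -eq_x -eq_y !expgnA eq_xy.
have /(congr1 size) := eq_word 1%N isT; have /(congr1 size) := eq_word 2%N isT.
rewrite !size_cat !size_inv_word !size_flatten_nseq => size2 size1.
have size_nc : (n * size c = n * size d)%N by lia.
have size_u : size u = size v by lia.
have size_c : size c = size d.
  by move/eqP: size_nc; rewrite eqn_pmul2l // => /eqP.
have /eqP := eq_word 1%N isT; rewrite eqseq_cat // => /andP[/eqP eq_uv].
rewrite eqseq_cat ?size_flatten_nseq ?size_c // muln1 => /andP[/eqP eq_cd _].
by rewrite def_x def_y eq_uv (flatten_nseq_inj n_gt0 size_c eq_cd).
Qed.

(** The powers [size d] of [c] and [size c] of [d] have equal lengths and are
    prefixes of the same word, since they commute. *)
Lemma catC_flatten_nseq (T : eqType) (c d : seq T) : c ++ d = d ++ c ->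
  flatten (nseq (size d) c) = flatten (nseq (size c) d).
Proof.
move=> cd.
have comm1 k : flatten (nseq k c) ++ d = d ++ flatten (nseq k c).
  by elim: k => [|k IHk] /=; rewrite ?cats0 // -catA IHk catA cd catA.
have comm k j :
    flatten (nseq k c) ++ flatten (nseq j d)
    = flatten (nseq j d) ++ flatten (nseq k c).
  by elim: j => [|j IHj] /=; rewrite ?cats0 // catA comm1 -catA IHj catA.
have /eqP := comm (size d) (size c).
by rewrite eqseq_cat ?size_flatten_nseq 1?mulnC // => /andP[/eqP].
Qed.

Lemma reduced_rcons_cat u y x v :
  reduced (rcons u y ++ x :: v)
  = [&& reduced (rcons u y), x != inv_letter y & reduced (x :: v)].
Proof.
rewrite /reduced sorted_cat_cons -cats1 -cats1 -catA sorted_cat_cons /= andbT.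
by rewrite -andbA cats1.
Qed.

(** If the last letter of [w] cancelled both with [c] and with its inverse, the
    first letter of [c] would be inverse to the last one, and [c ++ c] would
    not be reduced. *)
Lemma reduced_cat_cyclic (w c : word) :
  c != [::] -> reduced w -> reduced (c ++ c) ->
  reduced (w ++ c) \/ reduced (w ++ inv_word c).
Proof.
case/lastP: c => // c z _ red_w red_cc.
have red_c : reduced (rcons c z) by case/cat_sorted2: red_cc.
case/lastP: w red_w => [|w y] red_w; first by left.
have [x [c' def_c]] : exists x c', rcons c z = x :: c'.
  by case: (c) => [|x c']; [exists z, [::] | exists x, (rcons c' z)].
move: red_cc; rewrite {2}def_c reduced_rcons_cat => /and3P[_ neq_x _].
have [def_x|neq] := eqVneq x (inv_letter y); last first.
  by left; rewrite def_c reduced_rcons_cat red_w neq -def_c red_c.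
right; have red_ic : reduced (inv_word (rcons c z)) by rewrite reduced_inv_word.
move: red_ic; rewrite -cats1 inv_word_cat.
rewrite -[inv_word [:: z] ++ _]/(inv_letter z :: inv_word c).
move=> red_ic; rewrite reduced_rcons_cat red_w red_ic andbT.
by rewrite (can_eq inv_letterK); apply: contra neq_x => /eqP->; rewrite def_x.
Qed.

(** Both [w ++ e] and [e ++ w] represent the same element and have the same
    length, so if one is reduced they are equal as words. *)
Lemma commute_reduced_cat w e :
  reduced (w ++ e) -> commute (@env_class free_pres w) (env_class e) ->
  @env_class free_pres w ^+ size e = env_class e ^+ size w.
Proof.
move=> red_we; rewrite /commute -!env_class_cat => eq_we.
have red_eq : reduce (e ++ w) = w ++ e.
  by rewrite -(reduce_env_class eq_we) reduce_id.
have red_ew : reduced (e ++ w).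
  by apply: reduced_size_reduce; rewrite red_eq !size_cat addnC.
rewrite -!env_class_flatten_nseq catC_flatten_nseq //.
exact: reduced_class_inj eq_we.
Qed.

(** After conjugation [x] is cyclically reduced, and [y] can be multiplied by
    [x] or by its inverse without cancellation; the problem becomes one about
    commuting words in a free monoid. *)
Lemma free_group_commute (x y : envgroup free_pres) : x <> 1 -> commute x y ->
  exists a b, 0 < a /\ (y ^+ a = x ^+ b \/ y ^+ a = x ^- b).
Proof.
move=> /free_group_power_word[u [c [c_neq0 def_x red_cc _]]] comm_xy.
pose U := @env_class free_pres u; pose C := @env_class free_pres c.
have def_xJ : x = C ^ U^-1 by rewrite def_x conjgE invgK mulgA.
have [w red_w def_y] := reduced_env_class (y ^ U).
have def_yJ : y = env_class w ^ U^-1 by rewrite -def_y conjgK.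
have comm_wC : commute (@env_class free_pres w) C.
  apply: (conjg_inj U^-1); rewrite !conjMg -def_yJ -def_xJ; exact: commute_sym.
have c_gt0 : 0 < size c by case: (c) c_neq0.
exists (size c), (size w); split=> //.
rewrite def_xJ def_yJ -!conjXg -conjVg.
case: (reduced_cat_cyclic c_neq0 red_w red_cc) => [red_wc|red_wc].
  by left; rewrite (commute_reduced_cat red_wc).
right; rewrite -(size_inv_word c) (commute_reduced_cat red_wc).
  by rewrite env_class_inv expVgn.
by rewrite env_class_inv; apply: commuteV.
Qed.

End FreeGroup.

(** * Integer powers *)

Section IntegerPowers.
Variable G : groupType.
Implicit Types (x y : G) (k : int).

Lemma expgz_neg x n : expgz x (- Posz n)%R = x ^- n.
Proof. by case: n => [|n]; rewrite ?oppr0 ?invg1 // -NegzE. Qed.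

Lemma expgzS x k : expgz x (k + 1)%R = expgz x k * x.
Proof.
case: k => [n|n]; first by rewrite -PoszD addn1 /= expgSr.
have -> : (Negz n + 1 = - Posz n)%R by lia.
by rewrite expgz_neg /= expgS invgM mulgVK.
Qed.

Lemma commute_expgz x y k : commute x y -> commute x (expgz y k).
Proof. by move=> xy; case: k => n /=; [|apply: commuteV]; apply: commuteX. Qed.

Lemma expgz_expgn x n k : expgz (x ^+ n) k = expgz x (Posz n * k)%R.
Proof.
case: k => k; first by rewrite -PoszM /= expgnA.
by rewrite NegzE mulrN -PoszM !expgz_neg expgnA.
Qed.

End IntegerPowers.

(** * Groups with a free kernel over a central element *)

Section CentralByFree.
Variables (G : groupType) (weight : G -> int).
Hypothesis weightM : forall x y, weight (x * y) = (weight x + weight y)%R.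

Lemma weight1 : weight 1 = 0%R.
Proof. by have := weightM 1 1; rewrite mulg1; lia. Qed.

Lemma weightV x : weight x^-1 = (- weight x)%R.
Proof. by have := weightM x^-1 x; rewrite mulVg weight1; lia. Qed.

Lemma weightX x n : weight (x ^+ n) = (Posz n * weight x)%R.
Proof.
elim: n => [|n IHn]; first by rewrite expg0 weight1 mul0r.
by rewrite expgS weightM IHn intS mulrDl mul1r.
Qed.

Lemma weight_expgz x k : weight (expgz x k) = (k * weight x)%R.
Proof. by case: k => n /=; rewrite ?weightV weightX // NegzE mulNr. Qed.

Variables (X : choiceType) (psi : G -> envgroup (free_pres X)).
Hypothesis psiM : forall x y, weight x = 0%R -> psi (x * y) = psi x * psi y.
Hypothesis psi_inj : forall x y, weight x = 0%R -> weight y = 0%R ->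
  psi x = psi y -> x = y.

Lemma psi1 : psi 1 = 1.
Proof. by apply: (mulgI (psi 1)); rewrite -psiM ?weight1 // !mulg1. Qed.

Lemma psiX x n : weight x = 0%R -> psi (x ^+ n) = psi x ^+ n.
Proof.
by move=> wx; elim: n => [|n IHn]; [exact: psi1 | rewrite !expgS psiM ?IHn].
Qed.

Lemma psiV x : weight x = 0%R -> psi x^-1 = (psi x)^-1.
Proof. by move=> wx; apply: (mulgI (psi x)); rewrite -psiM // !mulgV psi1. Qed.

Lemma kernel_root_unique x y n : weight x = 0%R -> weight y = 0%R ->
  0 < n -> x ^+ n = y ^+ n -> x = y.
Proof.
move=> wx wy n_gt0 eq_xy; apply: psi_inj => //.
by apply: (free_group_root_unique n_gt0); rewrite -!psiX // eq_xy.
Qed.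

Lemma kernel_commute x y : weight x = 0%R -> weight y = 0%R ->
  x <> 1 -> commute x y ->
  exists a b, 0 < a /\ (y ^+ a = x ^+ b \/ y ^+ a = x ^- b).
Proof.
move=> wx wy x_neq1 xy.
have psix_neq1 : psi x <> 1.
  by rewrite -psi1 => /psi_inj; rewrite weight1 => /(_ wx erefl).
have psi_xy : commute (psi x) (psi y) by rewrite /commute -!psiM // xy.
have [a [b [a_gt0 eq_ab]]] := free_group_commute psix_neq1 psi_xy.
have wX t n : weight t = 0%R -> weight (t ^+ n) = 0%R.
  by move=> wt; rewrite weightX wt mulr0.
exists a, b; split=> //; case: eq_ab => eq_ab; [left|right]; apply: psi_inj.
- exact: wX.
- exact: wX.
- by rewrite !psiX.
- exact: wX.
- by rewrite weightV wX ?oppr0.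
- by rewrite psiV ?wX ?psiX.
Qed.

Variables (z : G) (kappa : nat).
Hypothesis z_central : forall x, commute x z.
Hypotheses (kappa_gt0 : 0 < kappa) (weight_z : weight z = Posz kappa).

(** Dividing [x ^+ kappa] by the power of [z] of the same weight gives an
    element [f] of the kernel, which depends only on [x ^+ n]. The case [f = 1]
    is the second alternative. For [f <> 1] the quotient [y / x] is
    commensurable with [f], hence commutes with [x], and is a torsion element
    of the kernel. *)
Lemma roots_equal_or_central (x y : G) n : 0 < n -> x ^+ n = y ^+ n ->
  x = y \/ x ^+ kappa = expgz z (weight x) /\ y ^+ kappa = expgz z (weight y).
Proof.
move=> n_gt0 eq_xy.
have eq_w : weight y = weight x.
  have /eqP := congr1 weight eq_xy; rewrite !weightX.
  by move=> /eqP; nia.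
pose zeta := expgz z (weight x); pose f := x ^+ kappa / zeta.
have zetaC t : commute t zeta by apply: commute_expgz.
have w_zeta : weight zeta = (Posz kappa * weight x)%R.
  by rewrite weight_expgz weight_z mulrC.
have w_f : weight f = 0%R by rewrite weightM weightV weightX w_zeta subrr.
have def_f : f = y ^+ kappa / zeta.
  apply: (@kernel_root_unique _ _ n) => //.
    by rewrite weightM weightV weightX w_zeta eq_w subrr.
  by rewrite !expgnFl // expgnAC eq_xy expgnAC.
have [f1|/eqP f_neq1] := eqVneq f 1.
  right; rewrite eq_w; split; apply: divg1_eq; first exact: f1.
  by rewrite -/zeta -def_f.
left; pose g := y / x.
have w_g : weight g = 0%R by rewrite weightM weightV eq_w subrr.
have fx : commute f x.
  apply/commute_sym/commuteM; first exact: commuteX.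
  exact/commuteV/zetaC.
have fy : commute f y.
  rewrite def_f; apply/commute_sym/commuteM; first exact: commuteX.
  exact/commuteV/zetaC.
have fg : commute f g by apply: commuteM => //; apply: commuteV.
have [a [b [a_gt0 eq_ab]]] := kernel_commute w_f w_g f_neq1 fg.
have gaJ : (g ^+ a) ^ x = g ^+ a.
  apply/conjg_fixP/commgP/commute_sym.
  by case: eq_ab => ->; [|apply: commuteV]; apply/commuteX/commute_sym.
have gJ : g ^ x = g.
  apply: (@kernel_root_unique _ _ a) => //; last by rewrite -conjXg.
  by rewrite conjgE weightM [weight (g * x)]weightM weightV w_g add0r addNr.
have gx : commute g x by apply/commgP; rewrite -conjg_fix gJ.
have gn1 : g ^+ n = 1 ^+ n.
  rewrite expg1n; apply: (mulIg (x ^+ n)).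
  by rewrite -expgMn // mulgVK mul1g eq_xy.
apply/esym/divg1_eq.
exact: (kernel_root_unique w_g weight1 n_gt0 gn1).
Qed.

End CentralByFree.

(** * Cocycles on a presented group *)

Section Cocycle.
Variables (P : presentation) (T : groupType).
(* [E x k] is the value of the letter [x] when it is read at level [k]. *)
Variables (wt : gens P -> int) (E : gens P -> int -> T).

Fixpoint word_weight (w : seq (gens P * bool)) : int :=
  if w is (x, b) :: w' then ((if b then wt x else - wt x) + word_weight w')%R
  else 0%R.

(** An inverse letter first goes down to the level from which the letter itself
    would start, so that a letter followed by its inverse has trivial value. *)
Fixpoint word_cocycle (k : int) (w : seq (gens P * bool)) : T :=
  match w with
  | [::] => 1
  | (x, true) :: w' => E x k * word_cocycle (k + wt x)%R w'
  | (x, false) :: w' => (E x (k - wt x)%R)^-1 * word_cocycle (k - wt x)%R w'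
  end.

Lemma word_weight_cat u v :
  word_weight (u ++ v) = (word_weight u + word_weight v)%R.
Proof. by elim: u => [|[x b] u IHu] /=; rewrite ?add0r // IHu addrA. Qed.

Lemma word_cocycle_cat k u v :
  word_cocycle k (u ++ v)
  = word_cocycle k u * word_cocycle (k + word_weight u)%R v.
Proof.
elim: u k => [|[x b] u IHu] k /=; first by rewrite mul1g addr0.
by case: b; rewrite IHu mulgA addrA.
Qed.

Hypothesis weight_rels : forall u v, @rels P u v ->
  word_weight (positive_word u) = word_weight (positive_word v).
Hypothesis cocycle_rels : forall u v, @rels P u v -> forall k,
  word_cocycle k (positive_word u) = word_cocycle k (positive_word v).

Lemma word_eq_weight u v : word_eq u v -> word_weight u = word_weight v.
Proof.
elim=> {u v} [//|//|u v w _ -> //|u u' v v' _ IH1 _ IH2|x b|u v /weight_rels//].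
  by rewrite !word_weight_cat IH1 IH2.
by case: b => /=; rewrite addr0 ?addNr ?subrr.
Qed.

Lemma word_eq_cocycle u v :
  word_eq u v -> forall k, word_cocycle k u = word_cocycle k v.
Proof.
elim=> {u v} [//|u v _ IH k //|u v w _ IH1 _ IH2 k|u u' v v' eq_u IH1 _ IH2 k
  |x [] k /=|u v /cocycle_rels//].
- by rewrite IH1.
- by rewrite !word_cocycle_cat IH1 IH2 (word_eq_weight eq_u).
- by rewrite addrK mulg1 mulgV.
- by rewrite mulg1 mulVg.
Qed.

Definition env_weight (x : envgroup P) : int := word_weight (repr x).
Definition env_cocycle (k : int) (x : envgroup P) : T :=
  word_cocycle k (repr x).

Lemma env_weightE w : env_weight (env_class w) = word_weight w.
Proof. exact/word_eq_weight/repr_class. Qed.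

Lemma env_cocycleE k w : env_cocycle k (env_class w) = word_cocycle k w.
Proof. exact/word_eq_cocycle/repr_class. Qed.

Lemma env_weightM x y : env_weight (x * y) = (env_weight x + env_weight y)%R.
Proof. by rewrite [x * y]/(env_class _) env_weightE word_weight_cat. Qed.

Lemma env_cocycleM k x y :
  env_cocycle k (x * y) = env_cocycle k x * env_cocycle (k + env_weight x)%R y.
Proof. by rewrite [x * y]/(env_class _) env_cocycleE word_cocycle_cat. Qed.

End Cocycle.

(** * Evaluating the free group on the set of elements of a group *)

Section FreeEvaluation.
Variable G : groupType.

Definition free_gen (g : G) : envgroup (free_pres G) :=
  @env_class (free_pres G) [:: (g, true)].

(** With all weights zero, a cocycle is a homomorphism. *)
Definition free_eval : envgroup (free_pres G) -> G :=
  @env_cocycle (free_pres G) G (fun _ => 0%R) (fun g _ => g) 0%R.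

Lemma free_weight0 w : @word_weight (free_pres G) (fun _ => 0%R) w = 0%R.
Proof.
by elim: w => [//|[x b] w /= ->]; rewrite addr0; case: b; rewrite ?oppr0.
Qed.

Lemma free_evalM x y : free_eval (x * y) = free_eval x * free_eval y.
Proof.
rewrite /free_eval env_cocycleM => [|u v []|u v []].
by rewrite /env_weight free_weight0.
Qed.

Lemma free_eval_gen g : free_eval (free_gen g) = g.
Proof.
by rewrite /free_eval env_cocycleE => [|u v []|u v []] /=; rewrite mulg1.
Qed.

Lemma free_eval1 : free_eval 1 = 1.
Proof. by apply: (mulgI (free_eval 1)); rewrite -free_evalM !mulg1. Qed.

Lemma free_evalV x : free_eval x^-1 = (free_eval x)^-1.
Proof.
by apply: (mulgI (free_eval x)); rewrite -free_evalM !mulgV free_eval1.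
Qed.

End FreeEvaluation.

(** * The weight kernel of a hosohedral-type group *)

Section Hosohedral.
Variables (h : nat) (h_gt0 : 0 < h) (m l : 'I_h -> nat).
Hypothesis m_gt0 : forall j : 'I_h, 0 < m j.
Hypothesis l_gt0 : forall j : 'I_h, 0 < l j.

Let P := hosohedral h_gt0 l m_gt0.
Let G : groupType := envgroup P.

Definition node j (i : 'I_(m j)) : gens P :=
  @Tagged 'I_h j (fun j => gens (circular (l j) (m_gt0 j))) i.
Definition next_letter (x : gens P) : gens P := node (ordS (tagged x)).
Definition prev_letter (x : gens P) : gens P := node (ord_pred (tagged x)).

Lemma nextK : cancel next_letter prev_letter.
Proof. by case=> j i; rewrite /prev_letter /next_letter /node /= ordSK. Qed.

Lemma prevK : cancel prev_letter next_letter.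
Proof. by case=> j i; rewrite /prev_letter /next_letter /node /= ord_predK. Qed.

Lemma tag_iter_next n x : tag (iter n next_letter x) = tag x.
Proof. by elim: n. Qed.

Lemma iter_nextK n : cancel (iter n prev_letter) (iter n next_letter).
Proof. by elim: n => [//|n IHn] x; rewrite iterSr /= prevK IHn. Qed.

Lemma iter_next_period x n : m (tag x) %| n -> iter n next_letter x = x.
Proof.
case: x => j i /= /dvdnP[q ->].
have iterE p : iter p next_letter (node i) = node (iter p (@ordS (m j)) i).
  by elim: p => [//|p /= ->].
rewrite [LHS]iterE; congr node; apply: val_inj.
have val_iter p : val (iter p (@ordS (m j)) i) = (i + p) %% m j.
  elim: p => [|p IHp]; first by rewrite addn0 modn_small.
  by rewrite iterS /= IHp -[_.+1 in LHS]addn1 modnDml -addnA addn1.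
by rewrite val_iter addnC modnMDl modn_small.
Qed.

Definition letter (x : gens P) : G := env_class [:: (x, true)].
Definition arc (x : gens P) (n : nat) : G :=
  env_class (positive_word (traject next_letter x n)).
Local Notation Delta := (env_garside P).

Lemma dprod_in_factor_word j (i : 'I_(m j)) n :
  dprod_in (factor_word i n : seq (gens (circular (l j) (m_gt0 j))))
  = traject next_letter (node i) n.
Proof. by elim: n i => [//|n IHn] i; rewrite /= -IHn. Qed.

Lemma arcS x n : arc x n.+1 = letter x * arc (next_letter x) n.
Proof. by rewrite /letter -env_class_cat. Qed.

Lemma arcSr x n : arc x n.+1 = arc x n * letter (iter n next_letter x).
Proof.
rewrite /letter -env_class_cat /arc trajectSr /positive_word map_rcons.
by rewrite -cats1.
Qed.

(** The relations rotate the starting point of an arc of full length one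
    position at a time, and the full arcs of different factors are identified
    from one chosen starting point. *)
Lemma arc_garside x : arc x (l (tag x)) = Delta.
Proof.
case: x => j i /=; rewrite -[existT _ _ _]/(node i).
have arc_next (i' : 'I_(m j)) :
    arc (node i') (l j) = arc (node (ordS i')) (l j).
  rewrite /arc -!dprod_in_factor_word; apply/env_classP/WordRel.
  apply: (@DprodFactor h (fun j => circular (l j) (m_gt0 j)) j
    (factor_word i' (l j)) (factor_word (ordS i') (l j))).
  exact: CircularRel.
have arc0 : arc (node i) (l j) = arc (node (Ordinal (m_gt0 j))) (l j).
  case: i => i lt_i; elim: i lt_i => [|i IHi] lt_i.
    by rewrite (_ : Ordinal lt_i = Ordinal (m_gt0 j)) //; apply: val_inj.
  rewrite -(IHi (ltnW lt_i)) [RHS]arc_next.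
  rewrite (_ : ordS (Ordinal (ltnW lt_i)) = Ordinal lt_i) //.
  by apply: val_inj; rewrite /= modn_small.
rewrite arc0 /arc -dprod_in_factor_word; apply/env_classP/WordRel.
exact: (@DprodGarside h (fun j => circular (l j) (m_gt0 j)) j (Ordinal h_gt0)).
Qed.

Lemma letter_garside x :
  letter x * Delta = Delta * letter (iter (l (tag x)) next_letter x).
Proof.
by rewrite -{1}(arc_garside (next_letter x)) -arcS arcSr arc_garside.
Qed.

Lemma letter_garsideX x n :
  letter x * Delta ^+ n
  = Delta ^+ n * letter (iter (n * l (tag x))%N next_letter x).
Proof.
elim: n => [|n IHn]; first by rewrite mulg1 mul1g.
rewrite expgSr mulgA IHn -!mulgA letter_garside tag_iter_next.
by rewrite -iterD mulSn.
Qed.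

(** A common multiple of the [m j], so that conjugation by this power of [Delta]
    brings each index back to itself. *)
Definition garside_period := (\prod_(j < h) m j)%N.
Definition garside_weight := (\prod_(j < h) l j)%N.

Lemma letter_ind (Q : G -> Prop) :
  Q 1 -> (forall x y, Q x -> Q y -> Q (x * y)) ->
  (forall x, Q x -> Q x^-1) -> (forall x, Q (letter x)) -> forall x, Q x.
Proof.
move=> Q1 QM QV Ql x; rewrite -(env_reprK x).
elim: (repr x) => [//|[y b] w IHw].
rewrite -cat1s env_class_cat; apply: QM => //.
case: b; first exact: Ql.
rewrite (_ : env_class _ = (letter y)^-1); last by rewrite -env_class_inv.
exact/QV/Ql.
Qed.

Lemma garside_period_central (x : G) : commute x (Delta ^+ garside_period).
Proof.
elim/letter_ind: x => [|x y cx cy|x cx|x].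
- exact/commute_sym/commute1.
- by apply/commute_sym/commuteM; apply: commute_sym.
- by apply/commute_sym/commuteV/commute_sym.
rewrite /commute letter_garsideX iter_next_period //.
by rewrite dvdn_mulr // /garside_period (bigD1 (tag x)) //= dvdn_mulr.
Qed.

Definition letter_weight (x : gens P) : int :=
  Posz (garside_weight %/ l (tag x)).

Lemma letter_weightM x :
  (letter_weight x * Posz (l (tag x)) = Posz garside_weight)%R.
Proof.
rewrite /letter_weight -PoszM divnK //.
by rewrite /garside_weight (bigD1 (tag x)) //= dvdn_mulr.
Qed.

Lemma garside_weight_gt0 : 0 < garside_weight.
Proof. exact: prodn_gt0. Qed.

Lemma letter_weight_next x : letter_weight (next_letter x) = letter_weight x.
Proof. by []. Qed.

Lemma letter_weight_neq0 x : letter_weight x != 0%R.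
Proof.
apply: contraTneq garside_weight_gt0 => w0.
by have := letter_weightM x; rewrite w0 mul0r => -[<-].
Qed.

(** The product of the [u] letters that precede [x] on its circle, read as an
    inverse product of the letters from [x] on when [u] is negative. *)
Definition arc_to (x : gens P) (u : int) : G :=
  match u with
  | Posz n => arc (iter n prev_letter x) n
  | Negz n => (arc x n.+1)^-1
  end.

Lemma arc_to_next x u :
  arc_to (next_letter x) (u + 1)%R = arc_to x u * letter x.
Proof.
case: u => n.
  by rewrite -PoszD addn1 /= -iterS iterSr nextK arcSr iter_nextK.
have -> : (Negz n + 1 = - Posz n)%R by lia.
rewrite /arc_to arcS invgM mulgVK; case: n => [|n]; last by rewrite -NegzE.
by rewrite oppr0 /arc invg1.
Qed.

Definition garside_floor (k : int) : G :=
  expgz Delta (k %/ Posz garside_weight)%Z.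

Lemma garside_floorS k :
  garside_floor (k + Posz garside_weight)%R = garside_floor k * Delta.
Proof.
rewrite /garside_floor addrC -{1}[Posz garside_weight]mul1r divzMDl.
  by rewrite addrC expgzS.
by have := garside_weight_gt0; lia.
Qed.

(** The first factor accounts for the letters read along the circle of [x] from
    a level of bounded size up to level [k], the second one for the number of
    times that an increase by the weight of [Delta] fits into [k]. *)
Definition potential (x : gens P) (k : int) : G :=
  arc_to x (k %/ letter_weight x)%Z * (garside_floor k)^-1.

Lemma potential_next x k :
  potential (next_letter x) (k + letter_weight x)%R
  = potential x k * garside_floor k * letter x
    * (garside_floor (k + letter_weight x)%R)^-1.
Proof.
rewrite /potential mulgVK -arc_to_next letter_weight_next.
rewrite addrC -{1}[letter_weight x]mul1r divzMDl ?letter_weight_neq0 //.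
by rewrite [(1 + _)%R]addrC [(letter_weight x + k)%R]addrC.
Qed.

Lemma potential_iter_next x n k :
  potential (iter n next_letter x) (k + Posz n * letter_weight x)%R
  = potential x k * garside_floor k * arc x n
    * (garside_floor (k + Posz n * letter_weight x)%R)^-1.
Proof.
elim: n => [|n IHn]; first by rewrite mul0r addr0 mulg1 mulgK.
have -> : (k + Posz n.+1 * letter_weight x
    = k + Posz n * letter_weight x + letter_weight (iter n next_letter x))%R.
  have -> : letter_weight (iter n next_letter x) = letter_weight x.
    by rewrite /letter_weight tag_iter_next.
  by rewrite intS mulrDl mul1r addrAC addrA.
by rewrite potential_next IHn mulgVK arcSr !mulgA.
Qed.

(** A full arc contributes a factor [Delta], which the increase of
    [garside_floor] by one cancels. *)
Lemma potential_period x k :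
  potential (iter (l (tag x)) next_letter x) (k + Posz garside_weight)%R
  = potential x k.
Proof.
rewrite -(letter_weightM x) mulrC potential_iter_next arc_garside.
rewrite [(Posz _ * _)%R]mulrC letter_weightM garside_floorS.
by rewrite -[_ * garside_floor k * Delta]mulgA mulgK.
Qed.

(** As a quotient of potentials it telescopes along a circle, and by
    [potential_next] it evaluates in [G] to [x], up to powers of [Delta]
    attached to the two levels. *)
Definition free_step (x : gens P) (k : int) : envgroup (free_pres G) :=
  (free_gen (potential x k))^-1
  * free_gen (potential (next_letter x) (k + letter_weight x)%R).

Lemma word_weight_traject x n :
  word_weight letter_weight (positive_word (traject next_letter x n))
  = (Posz n * letter_weight x)%R.
Proof.
elim: n x => [|n IHn] x /=; first by rewrite mul0r.
by rewrite IHn letter_weight_next intS mulrDl mul1r.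
Qed.

Lemma word_cocycle_traject x n k :
  word_cocycle letter_weight free_step k
    (positive_word (traject next_letter x n))
  = (free_gen (potential x k))^-1
    * free_gen
        (potential (iter n next_letter x) (k + Posz n * letter_weight x)%R).
Proof.
elim: n x k => [|n IHn] x k; first by rewrite mul0r addr0 mulVg.
rewrite /= IHn /free_step letter_weight_next -mulgA mulVKg.
rewrite -iterSr -iterS; congr (_ * free_gen (potential _ _)).
by rewrite intS mulrDl mul1r addrA.
Qed.

Lemma arc_relation x :
  let w := positive_word (traject next_letter x (l (tag x))) in
  word_weight letter_weight w = Posz garside_weight
  /\ forall k, word_cocycle letter_weight free_step k w = 1.
Proof.
split=> [|k]; first by rewrite word_weight_traject mulrC letter_weightM.
by rewrite word_cocycle_traject mulrC letter_weightM potential_period mulVg.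
Qed.

Lemma hosohedral_rels u v : @rels P u v ->
  exists x y, u = traject next_letter x (l (tag x))
    /\ v = traject next_letter y (l (tag y)).
Proof.
case=> [j _ _ [i]|j k]; [exists (node i), (node (ordS i)) |
  exists (node (Ordinal (m_gt0 j))), (node (Ordinal (m_gt0 k)))];
  by rewrite -!dprod_in_factor_word.
Qed.

Lemma weight_rels_hosohedral u v : @rels P u v ->
  word_weight letter_weight (positive_word u)
  = word_weight letter_weight (positive_word v).
Proof.
case/hosohedral_rels => x [y [-> ->]].
by case: (arc_relation x) (arc_relation y) => -> _ [-> _].
Qed.

Lemma cocycle_rels_hosohedral u v : @rels P u v -> forall k,
  word_cocycle letter_weight free_step k (positive_word u)
  = word_cocycle letter_weight free_step k (positive_word v).
Proof.
case/hosohedral_rels => x [y [-> ->]] k.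
by case: (arc_relation x) (arc_relation y) => _ -> [_ ->].
Qed.

(** The powers of [Delta] at intermediate levels cancel; for a word of weight
    zero read from level zero, those at both ends are trivial as well. *)
Lemma free_eval_cocycle w k :
  free_eval (word_cocycle letter_weight free_step k w)
  = garside_floor k * env_class w
    * (garside_floor (k + word_weight letter_weight w)%R)^-1.
Proof.
have eval_free_step x i : free_eval (free_step x i)
    = garside_floor i * letter x * (garside_floor (i + letter_weight x)%R)^-1.
  rewrite /free_step free_evalM free_evalV !free_eval_gen potential_next.
  by move: (potential x i) => r; rewrite -!mulgA mulKg.
elim: w k => [|[x b] w IHw] k.
  by rewrite /= free_eval1 addr0 mulg1 mulgV.
rewrite -[_ :: w]cat1s env_class_cat; case: b => /=.
  by rewrite free_evalM eval_free_step IHw addrA -!mulgA mulKg.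
rewrite free_evalM free_evalV eval_free_step subrK IHw addrA !invgM invgK.
have -> : env_class [:: (x, false)] = (letter x)^-1.
  by rewrite /letter -env_class_inv.
by rewrite -!mulgA mulKg.
Qed.

Definition weight : G -> int := env_weight letter_weight.
Definition to_free : G -> envgroup (free_pres G) :=
  env_cocycle letter_weight free_step 0%R.

Lemma weightM x y : weight (x * y) = (weight x + weight y)%R.
Proof. exact: env_weightM weight_rels_hosohedral x y. Qed.

Lemma to_freeM x y : weight x = 0%R -> to_free (x * y) = to_free x * to_free y.
Proof.
move=> wx.
have := env_cocycleM weight_rels_hosohedral cocycle_rels_hosohedral 0%R x y.
by rewrite -/(weight x) wx addr0.
Qed.

Lemma free_eval_to_free x : weight x = 0%R -> free_eval (to_free x) = x.
Proof.
rewrite /weight /env_weight => w0; rewrite free_eval_cocycle w0 env_reprK.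
by rewrite /garside_floor div0z /= mul1g invg1 mulg1.
Qed.

Lemma weight_garside : weight Delta = Posz garside_weight.
Proof.
have [w_arc _] := arc_relation (node (Ordinal (m_gt0 (Ordinal h_gt0)))).
rewrite -w_arc -(arc_garside (node (Ordinal (m_gt0 (Ordinal h_gt0))))).
exact: env_weightE weight_rels_hosohedral _.
Qed.

Lemma hosohedral_roots_equal_or_periodic (x y : G) n : 0 < n ->
  x ^+ n = y ^+ n -> x = y \/ periodic x /\ periodic y.
Proof.
move=> n_gt0 eq_xy; pose kappa := (garside_period * garside_weight)%N.
have kappa_gt0 : 0 < kappa by rewrite muln_gt0 !prodn_gt0.
have weight_z : weight (Delta ^+ garside_period) = Posz kappa.
  by rewrite (weightX weightM) weight_garside PoszM.
have to_free_inj (s t : G) : weight s = 0%R -> weight t = 0%R ->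
    to_free s = to_free t -> s = t.
  move=> ws wt eq_st.
  by rewrite -(free_eval_to_free ws) eq_st free_eval_to_free.
have periodicI (t : G) :
    t ^+ kappa = expgz (Delta ^+ garside_period) (weight t) -> periodic t.
  move=> def_t; exists (Posz kappa), (Posz garside_period * weight t)%R.
  by split; [case: kappa kappa_gt0 {weight_z def_t} | rewrite -expgz_expgn].
have := roots_equal_or_central weightM to_freeM to_free_inj
  garside_period_central kappa_gt0 weight_z n_gt0 eq_xy.
by case=> [|[/periodicI px /periodicI py]]; [left | right].
Qed.

End Hosohedral.

(** * Roots in hosohedral-type groups *)

Theorem theorem3p21 (h : nat) (h_gt0 : 0 < h) (m l : 'I_h -> nat)
    (m_gt0 : forall j : 'I_h, 0 < m j) (l_gt0 : forall j : 'I_h, 0 < l j)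
    (alpha beta : envgroup (hosohedral h_gt0 l m_gt0)) (n : int) :
  n <> 0%Z ->
  expgz alpha n = expgz beta n ->
  conjugate alpha beta
  \/ (~ conjugate alpha beta /\ periodic alpha /\ periodic beta).
Proof.
move=> n_neq0 eq_n.
have [p p_gt0 eq_p] : exists2 p, 0 < p & alpha ^+ p = beta ^+ p.
  by case: n n_neq0 eq_n => [[//|p] _ eq_p|p _ /invg_inj eq_p]; exists p.+1.
have [conj|nconj] := EM (conjugate alpha beta); [by left | right; split=> //].
have [eq_ab|//] := hosohedral_roots_equal_or_periodic l_gt0 p_gt0 eq_p.
by case: nconj; exists 1; rewrite conjg1 eq_ab.
Qed.
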